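(* Let $\delta t>0$ and suppose that $(\phi^n,r^n)$ and $(\phi^{n+1},\mu^{n+1},r^{n+1})$ satisfy the first-order scheme (with $r$ treated explicitly) $$\frac{\phi^{n+1}-\phi^n}{\delta t}=-\mathcal{G}\mu^{n+1},$$ $$\mu^{n+1}=\mathcal{L}\phi^{n+1}+\frac{r^{n}}{G\left(\int_{\Omega}F(\phi^n)\,dx\right)}F'(\phi^n),$$ $$\frac{G^{-1}(r^{n+1})-G^{-1}(r^n)}{\delta t}=\frac{r^{n}}{G\left(\int_{\Omega}F(\phi^n)\,dx\right)}\left(F'(\phi^n),\frac{\phi^{n+1}-\phi^n}{\delta t}\right).$$ Then the scheme is unconditionally energy stable, in the sense that (for every $\delta t>0$) $$\tilde E^{n+1}-\tilde E^{n}\le -\delta t\,(\mathcal{G}\mu^{n+1},\mu^{n+1}),$$ where $\tilde E^k=\int_\Omega \frac12\,\mathcal{L}\phi^k\cdot\phi^k\,dx+G^{-1}(r^k)$.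
   Context: $\Omega$ is a bounded spatial domain, $(\cdot,\cdot)$ is the $L^2(\Omega)$ inner product. $\mathcal{L}$ is a linear, self-adjoint, positive operator (so $(\mathcal{L}u,v)=(u,\mathcal{L}v)$ and $(\mathcal{L}u,u)\ge 0$); $\mathcal{G}$ is a positive operator ($(\mathcal{G}u,u)\ge 0$). $F$ is a nonlinear potential and $F'(\phi)$ its (variational) derivative. $G$ is an invertible scalar function with inverse $G^{-1}$ (not to be confused with the operator $\mathcal{G}$). The unknowns $\phi^k,\mu^k$ are real-valued functions on $\Omega$, regular enough that all expressions make sense, satisfying either periodic boundary conditions or homogeneous Neumann conditions $\partial_{\mathbf n}\phi=\partial_{\mathbf n}\mu=0$ on $\partial\Omega$; the $r^k$ are real scalars in the domain of $G^{-1}$; it is understood that $G(\int_\Omega F(\phi^n)\,dx)$ is defined and nonzero. The scheme discretizes the gradient flow $\phi_t=-\mathcal{G}\mu$, $\mu=\mathcal{L}\phi+F'(\phi)$ using the scalar auxiliary variable $r=G(\int_\Omega F(\phi)\,dx)$. *)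

(* Defs.v *)
From HB Require Import structures.
From mathcomp Require Import all_boot all_order all_algebra.
From mathcomp Require Import all_classical all_reals all_analysis.
Set Implicit Arguments.
Unset Strict Implicit.
Unset Printing Implicit Defensive.
Import Order.TTheory GRing.Theory Num.Theory.
Import numFieldNormedType.Exports.
Local Open Scope classical_set_scope.
Local Open Scope ring_scope.

(* Row vectors carry the sigma-algebra generated by the coordinates, as
   n.-tuple R does in the library; by [open_measurable_rV] below it contains
   the open sets, so it is the Borel sigma-algebra of R^n. *)
Definition rV_display : measure_display.
Proof. exact: default_measure_display. Qed.

Definition coord_rV (R : realType) (n : nat) (i : 'I_n) (x : 'rV[R]_n) :
  measurableTypeR R := x ord0 i.

Section measurable_rV.
Context {R : realType} {n : nat}.

Let rV_set0 : g_sigma_preimage (@coord_rV R n) set0.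
Proof. exact: sigma_algebra0. Qed.

Let rV_setC A :
  g_sigma_preimage (@coord_rV R n) A -> g_sigma_preimage (@coord_rV R n) (~` A).
Proof. exact: sigma_algebraC. Qed.

Let rV_bigcup (F : (set 'rV[R]_n)^nat) :
  (forall i, g_sigma_preimage (@coord_rV R n) (F i)) ->
  g_sigma_preimage (@coord_rV R n) (\bigcup_i (F i)).
Proof. exact: sigma_algebra_bigcup. Qed.

HB.instance Definition _ := @isMeasurable.Build rV_display
  'rV[R]_n (g_sigma_preimage (@coord_rV R n)) rV_set0 rV_setC rV_bigcup.

End measurable_rV.

Lemma measurable_coord_rV (R : realType) n (i : 'I_n) :
  measurable_fun [set: 'rV[R]_n] (coord_rV i).
Proof.
move=> _ Y mY; rewrite setTI; apply: sub_sigma_algebra => /=.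
rewrite -bigcup_seq/=; exists i => /=; first by rewrite mem_index_enum.
by exists Y => //; rewrite setTI.
Qed.

Lemma measurable_fun_coord_rV (R : realType) n d (T : measurableType d)
    (f : T -> 'rV[R]_n) :
  (forall i, measurable_fun [set: T] (coord_rV i \o f)) ->
  measurable_fun [set: T] f.
Proof.
move=> mf; suff : g_sigma_preimage (fun i => coord_rV i \o f) `<=` measurable.
  rewrite g_sigma_preimage_comp => sub _ A mA.
  by apply: sub; exists A.
apply: smallest_sub; first exact: sigma_algebra_measurable.
case: n f mf => [|m] f mf; first by rewrite big_ord0.
rewrite -bigcup_mkord_ord; apply: bigcup_sub => i Ii.
by move=> A [B mB <-]; exact: mf.
Qed.

Definition cons_rV (R : realType) n (xt : measurableTypeR R * 'rV[R]_n) :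
  'rV[R]_n.+1 := \row_i oapp (fun j => xt.2 ord0 j) xt.1 (unlift ord0 i).

Definition uncons_rV (R : realType) n (x : 'rV[R]_n.+1) :
  measurableTypeR R * 'rV[R]_n :=
  (x ord0 ord0, \row_i x ord0 (lift ord0 i)).

Lemma cons_rVK (R : realType) n : cancel (@cons_rV R n) (@uncons_rV R n).
Proof.
move=> [x t]; congr pair => /=; first by rewrite mxE unlift_none.
by apply/rowP => i; rewrite !mxE liftK.
Qed.

Lemma measurable_cons_rV (R : realType) n :
  measurable_fun [set: measurableTypeR R * 'rV[R]_n] (@cons_rV R n).
Proof.
apply: measurable_fun_coord_rV => i.
case: (unliftP ord0 i) => [j ->|->].
- rewrite (_ : _ \o _ = coord_rV j \o snd).
    by apply: measurableT_comp => //; exact: measurable_coord_rV.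
  by apply/funext => -[x t] /=; rewrite /coord_rV mxE liftK.
- rewrite (_ : _ \o _ = fst)//.
  by apply/funext => -[x t] /=; rewrite /coord_rV mxE unlift_none.
Qed.

Lemma measurable_uncons_rV (R : realType) n :
  measurable_fun [set: 'rV[R]_n.+1] (@uncons_rV R n).
Proof.
apply/measurable_fun_pairP; split; first exact: measurable_coord_rV.
apply: measurable_fun_coord_rV => i.
rewrite (_ : _ \o _ = coord_rV (lift ord0 i)); first exact: measurable_coord_rV.
by apply/funext => x /=; rewrite /coord_rV mxE.
Qed.

HB.instance Definition _ (R : realType) n := isMeasurableFun.Build _ _ _ _
  (@cons_rV R n) (@measurable_cons_rV R n).

Lemma sigma_finite_prod d1 d2 (T1 : measurableType d1) (T2 : measurableType d2)
    (R : realType) (m1 : {sigma_finite_measure set T1 -> \bar R})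
    (m2 : {sigma_finite_measure set T2 -> \bar R}) :
  sigma_finite setT (m1 \x m2)%E.
Proof.
have /sigma_finiteP[F [TF ndF Foo]] := sigma_finiteT m1.
have /sigma_finiteP[G [TG ndG Goo]] := sigma_finiteT m2.
exists (fun n => F n `*` G n).
  rewrite -setXTT TF TG predeqE => -[x y]; split.
    move=> [/= [n _ Fnx] [k _ Gky]]; exists (maxn n k) => //; split.
    - by move: x Fnx; exact/subsetPset/ndF/leq_maxl.
    - by move: y Gky; exact/subsetPset/ndG/leq_maxr.
  by move=> [n _ []/= ? ?]; split; exists n.
move=> k; have [? ?] := Foo k; have [? ?] := Goo k.
split; first exact: measurableX.
by rewrite product_measure1E// lte_mul_pinfty// ge0_fin_numE.
Qed.

Section cons_measure.
Context {R : realType} {n : nat}.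
Variable m : {sigma_finite_measure set 'rV[R]_n -> \bar R}.

Definition cons_measure : set 'rV[R]_n.+1 -> \bar R :=
  pushforward (@lebesgue_measure R \x m)%E (@cons_rV R n).

Let cons_measure0 : cons_measure set0 = 0%E.
Proof. exact: measure0. Qed.

Let cons_measure_ge0 A : (0 <= cons_measure A)%E.
Proof. exact: measure_ge0. Qed.

Let cons_measure_sigma_additive : semi_sigma_additive cons_measure.
Proof. exact: measure_semi_sigma_additive. Qed.

HB.instance Definition _ := isMeasure.Build _ _ _ cons_measure
  cons_measure0 cons_measure_ge0 cons_measure_sigma_additive.

Let cons_measure_sigma_finite : sigma_finite setT cons_measure.
Proof.
have [F TF mF] := sigma_finite_prod (@lebesgue_measure R) m.
exists (fun k => @uncons_rV R n @^-1` F k).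
  by rewrite -preimage_bigcup -TF preimage_setT.
move=> k; have [mFk Fkoo] := mF k; split.
  by rewrite -[X in measurable X]setTI; exact: measurable_uncons_rV.
rewrite /cons_measure /pushforward (_ : _ @^-1` _ = F k)//.
by apply/seteqP; split => xt /=; rewrite cons_rVK.
Qed.

HB.instance Definition _ := Measure_isSigmaFinite.Build _ _ _ cons_measure
  cons_measure_sigma_finite.

End cons_measure.

Fixpoint lebesgue_rV (R : realType) (n : nat) :
    {sigma_finite_measure set 'rV[R]_n -> \bar R} :=
  match n with
  | 0 => \d_ (0 : 'rV[R]_0)
  | n'.+1 => cons_measure (lebesgue_rV R n')
  end.

Lemma lebesgue_rV_box (R : realType) n (a b : 'rV[R]_n) :
  (forall i, a ord0 i <= b ord0 i) ->
  lebesgue_rV R n [set x | forall i, x ord0 i \in `]a ord0 i, b ord0 i[] =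
  (\prod_(i < n) (b ord0 i - a ord0 i))%:E.
Proof.
elim: n a b => [|n IH] a b ab.
  rewrite big_ord0 /= diracE mem_set//= => -[]//.
have mbox (c d : 'rV[R]_n) :
    measurable [set x : 'rV[R]_n | forall i, x ord0 i \in `]c ord0 i, d ord0 i[].
  rewrite (_ : [set _ | _] =
      \bigcap_i (coord_rV i @^-1` `]c ord0 i, d ord0 i[%classic)); last first.
    by apply/seteqP; split => x /= h i; [move=> _; exact: h|exact: h].
  apply: fin_bigcap_measurable => // i _.
  by rewrite -[X in measurable X]setTI; exact: measurable_coord_rV.
rewrite big_ord_recl EFinM /= /cons_measure /pushforward.
pose a' : 'rV[R]_n := \row_i a ord0 (lift ord0 i).
pose b' : 'rV[R]_n := \row_i b ord0 (lift ord0 i).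
rewrite (_ : _ @^-1` _ = `]a ord0 ord0, b ord0 ord0[%classic `*`
    [set x : 'rV[R]_n | forall i, x ord0 i \in `]a' ord0 i, b' ord0 i[]).
  rewrite product_measure1E; [|exact: measurable_itv|exact: mbox].
  rewrite IH; last by move=> i; rewrite !mxE.
  congr (_ * _)%E; last by congr EFin; apply: eq_bigr => i _; rewrite !mxE.
  rewrite [LHS]lebesgue_measure_itv/= lte_fin.
  have := ab ord0; rewrite le_eqVlt => /predU1P[->|->]; last by [].
  by rewrite ltxx subrr.
apply/seteqP; split => -[x t] /=.
  move=> h; split; first by have := h ord0; rewrite !mxE unlift_none.
  by move=> i; have := h (lift ord0 i); rewrite !mxE liftK.
move=> [hx ht] i; case: (unliftP ord0 i) => [j ->|->].
  by have := ht j; rewrite !mxE liftK.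
by rewrite !mxE unlift_none.
Qed.

Lemma open_measurable_rV (R : realType) n (U : set 'rV[R]_n) :
  open U -> measurable U.
Proof.
move=> oU.
pose B (p : 'rV[rat]_n * nat) : set 'rV[R]_n :=
  ball (map_mx ratr p.1 : 'rV[R]_n) (p.2.+1%:R^-1).
have mB p : measurable (B p).
  rewrite (_ : B p = \bigcap_i (coord_rV i @^-1`
      (ball (ratr (p.1 ord0 i) : R) p.2.+1%:R^-1))); last first.
    apply/seteqP; split => x /=.
      by move=> [_ h] i _; have := h ord0 i; rewrite mxE.
    move=> h; split; first by rewrite invr_gt0 ltr0n.
    by move=> i j; rewrite mxE ord1; exact: h.
  apply: fin_bigcap_measurable => // i _.
  rewrite -[X in measurable X]setTI; apply: measurable_coord_rV => //.
  by rewrite ball_itv; exact: measurable_itv.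
rewrite (_ : U = \bigcup_(p in [set p | B p `<=` U]) B p).
  rewrite bigcup_mkcond; apply: countable_bigcupT_measurable => //.
  by move=> p; case: ifPn.
apply/seteqP; split => x; last by move=> [p pU]; exact: pU.
move=> Ux; have [e /= e0 eU] : nbhs_ball x U.
  by apply/nbhs_ballP; exact: open_nbhs_nbhs.
have [k ke] : exists k : nat, k.+1%:R^-1 < e / 2.
  have e20 : 0 < e / 2 by rewrite divr_gt0.
  exists (Num.truncn (e / 2)^-1); rewrite invf_plt ?posrE ?ltr0n//.
  exact: truncnS_gt.
have k0 : 0 < k.+1%:R^-1 :> R by rewrite invr_gt0 ltr0n.
have q_ i : exists q : rat, ball (x ord0 i) k.+1%:R^-1 (ratr q : R).
  have : x ord0 i < x ord0 i + k.+1%:R^-1 by rewrite ltrDl.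
  move=> /rat_in_itvoo[q]; rewrite in_itv/= => /andP[q1 q2].
  by exists q; rewrite /ball/= ltr_distlC q2 andbT (lt_trans _ q1)// ltrBlDr ltrDl.
have [q hq] := choice q_.
exists (\row_i q i, k) => /=.
  have kke : k.+1%:R^-1 + k.+1%:R^-1 < e by rewrite [ltRHS]splitr ltrD.
  move=> y By; apply: eU; apply: (le_ball (ltW kke)).
  apply: ball_triangle By; split=> // i j.
  by rewrite ord1 !mxE; exact: hq.
by split=> // i j; rewrite ord1 !mxE; apply: ball_sym; exact: hq.
Qed.

Section notions.
Context {R : realType} {d : nat}.
Implicit Types (Omega : set 'rV[R]_d) (u v : 'rV[R]_d -> R)
  (X : set ('rV[R]_d -> R)).

Definition bounded_domain Omega :=
  [/\ Omega !=set0, open Omega, connected Omega & bounded_set Omega].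

Definition open_box (a b : 'rV[R]_d) : set 'rV[R]_d :=
  [set x | forall i, a ord0 i < x ord0 i < b ord0 i].

(* Functions on Omega are represented by total functions; only their values on
   Omega (on its closure, for boundary conditions) are meaningful. *)
Definition inner_L2 Omega u v : R :=
  \int[lebesgue_rV R d]_(x in Omega) (u x * v x).

Definition in_L2 Omega u : Prop := u \_ Omega \in Lfun (lebesgue_rV R d) 2%:E.

Definition euclidean_dot (x y : 'rV[R]_d) : R :=
  \sum_i x ord0 i * y ord0 i.

(* nu is the outward unit normal at a boundary point x where the boundary is
   C^1: near x, Omega is the sublevel set {rho < 0} of a C^1 function rho with
   rho x = 0 whose gradient at x is a positive multiple of nu. *)
Definition outward_normal Omega (x nu : 'rV[R]_d) : Prop :=
  euclidean_dot nu nu = 1 /\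
  exists (rho : 'rV[R]_d -> R) (c : R),
    [/\ \forall y \near x, Omega y <-> rho y < 0,
        \forall y \near x, differentiable rho y /\
          forall w, {for y, continuous (fun z => 'D_w rho z)},
        rho x = 0,
        0 < c &
        forall w, 'D_w rho x = c * euclidean_dot nu w].

(* The normal derivative is the one-sided derivative from inside Omega; it is
   required to vanish wherever the outward normal exists, so that corners of
   piecewise smooth domains are allowed. *)
Definition neumann_bc Omega u : Prop :=
  {within closure Omega, continuous u} /\
  forall x nu, (closure Omega `\` Omega) x -> outward_normal Omega x nu ->
    h^-1 * (u x - u (x - h *: nu)) @[h --> 0^'+] --> (0 : R).

(* u stands for the periodic extension to the whole space of a function on the
   box with corners a and b. *)
Definition periodic_bc (a b : 'rV[R]_d) u : Prop :=
  continuous u /\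
  forall x i, u (x + (b ord0 i - a ord0 i) *: delta_mx ord0 i) = u x.

Inductive boundary_condition :=
  | Periodic of 'rV[R]_d & 'rV[R]_d
  | Neumann.

Definition bc_fits Omega (bc : boundary_condition) : Prop :=
  match bc with
  | Periodic a b => (forall i, a ord0 i < b ord0 i) /\ Omega = open_box a b
  | Neumann => True
  end.

Definition bc_holds Omega (bc : boundary_condition) u : Prop :=
  match bc with
  | Periodic a b => periodic_bc a b u
  | Neumann => neumann_bc Omega u
  end.

(* X plays the role of a regularity class; the differential operators act on
   the functions of X which satisfy the boundary condition. *)
Definition admissible Omega (bc : boundary_condition) X :
  set ('rV[R]_d -> R) := X `&` [set u | bc_holds Omega bc u].

Definition linear_subspace X : Prop :=
  X (cst 0) /\
  forall (a : R) u v, X u -> X v -> X (fun x => a * u x + v x).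

Definition linear_operator Omega X
    (L : ('rV[R]_d -> R) -> ('rV[R]_d -> R)) : Prop :=
  forall (a : R) u v, X u -> X v -> forall x, Omega x ->
    L (fun y => a * u y + v y) x = a * L u x + L v x.

Definition L2_operator Omega X
    (L : ('rV[R]_d -> R) -> ('rV[R]_d -> R)) : Prop :=
  forall u, X u -> in_L2 Omega u /\ in_L2 Omega (L u).

(* Formal self-adjointness: no condition on the domain of the adjoint. *)
Definition selfadjoint_operator Omega X
    (L : ('rV[R]_d -> R) -> ('rV[R]_d -> R)) : Prop :=
  forall u v, X u -> X v -> inner_L2 Omega (L u) v = inner_L2 Omega u (L v).

Definition positive_operator Omega X
    (L : ('rV[R]_d -> R) -> ('rV[R]_d -> R)) : Prop :=
  forall u, X u -> 0 <= inner_L2 Omega (L u) u.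

Definition potential_integral Omega
    (F : ('rV[R]_d -> R) -> ('rV[R]_d -> R)) u : R :=
  \int[lebesgue_rV R d]_(x in Omega) F u x.

(* g is the L^2 gradient at u of the functional given by the density F, tested
   against directions in V. *)
Definition variational_derivative Omega (V : set ('rV[R]_d -> R))
    (F : ('rV[R]_d -> R) -> ('rV[R]_d -> R)) u g : Prop :=
  forall v, V v ->
    (\forall e \near (0 : R), (lebesgue_rV R d).-integrable Omega
       (fun x => (F (fun y => u y + e * v y) x)%:E)) /\
    is_derive (0 : R) (1 : R)
      (fun e : R => potential_integral Omega F (fun y => u y + e * v y))
      (inner_L2 Omega g v).

Definition modified_energy Omega
    (L : ('rV[R]_d -> R) -> ('rV[R]_d -> R)) (Ginv : R -> R) u (r : R) : R :=
  \int[lebesgue_rV R d]_(x in Omega) (2^-1 * (L u x * u x)) + Ginv r.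

End notions.

(* Main.v *)
Require Import Defs.
From HB Require Import structures.
From mathcomp Require Import all_boot all_order all_algebra.
From mathcomp Require Import all_classical all_reals all_analysis.
From mathcomp Require Import ring lra.
Set Implicit Arguments.
Unset Strict Implicit.
Unset Printing Implicit Defensive.
Import Order.TTheory GRing.Theory Num.Theory.
Import numFieldNormedType.Exports.
Local Open Scope classical_set_scope.
Local Open Scope ring_scope.

(* Write w = phi1 - phi0 and c = r0 / G(...). Testing the equation for mu1 with
   w = - dt * GG mu1 gives
     - dt (GG mu1, mu1) = (L phi1, w) + c (F' phi0, w),
   and the last term is Ginv r1 - Ginv r0. By self-adjointness
     (L phi1, w) = 1/2 (L phi1, phi1) - 1/2 (L phi0, phi0) + 1/2 (L w, w),
   whose last term is nonnegative. *)

Section inner_L2_theory.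
Context {R : realType} {d : nat}.
Variable Omega : set 'rV[R]_d.
Hypothesis mOmega : measurable Omega.
Implicit Types (u v w : 'rV[R]_d -> R).

(** Hölder's inequality with exponents 2 and 2, applied to the extensions by zero: their product is
    the extension by zero of [u x * v x]. *)
Lemma in_L2_integrableM u v : in_L2 Omega u -> in_L2 Omega v ->
  (lebesgue_rV R d).-integrable Omega (EFin \o (fun x => u x * v x)).
Proof.
move=> uL2 vL2; apply/(integrable_mkcond _ mOmega).
have /Lfun1_integrable := Lfun2_mul_Lfun1 uL2 vL2.
congr (integrable _ _ _); apply/funext => x /=.
by rewrite !patchE; case: ifP => //= _; rewrite mulr0.
Qed.

Lemma eq_inner_L2 u1 u2 v1 v2 :
  {in Omega, u1 =1 u2} -> {in Omega, v1 =1 v2} ->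
  inner_L2 Omega u1 v1 = inner_L2 Omega u2 v2.
Proof.
by move=> uE vE; apply: eq_Rintegral => x Ox; rewrite uE// vE.
Qed.

Lemma inner_L2C u v : inner_L2 Omega u v = inner_L2 Omega v u.
Proof. by apply: eq_Rintegral => x _; rewrite mulrC. Qed.

Lemma inner_L2Zl (a : R) u v : in_L2 Omega u -> in_L2 Omega v ->
  inner_L2 Omega (fun x => a * u x) v = a * inner_L2 Omega u v.
Proof.
move=> uL2 vL2; rewrite /inner_L2 -RintegralZl//; last exact: in_L2_integrableM.
by apply: eq_Rintegral => x _; rewrite mulrA.
Qed.

Lemma inner_L2Pl (a : R) u v w :
  in_L2 Omega u -> in_L2 Omega v -> in_L2 Omega w ->
  inner_L2 Omega (fun x => a * u x + v x) w =
  a * inner_L2 Omega u w + inner_L2 Omega v w.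
Proof.
move=> uL2 vL2 wL2; rewrite -inner_L2Zl// /inner_L2 -RintegralD//.
- by apply: eq_Rintegral => x _; rewrite mulrDl.
- have := integrableZl mOmega a (in_L2_integrableM uL2 wL2).
  by congr (integrable _ _ _); apply/funext => x /=; rewrite -EFinM mulrA.
- exact: in_L2_integrableM.
Qed.

End inner_L2_theory.

Section admissible_theory.
Context {R : realType} {d : nat}.
Implicit Types (Omega : set 'rV[R]_d) (u v : 'rV[R]_d -> R).

(** Both conditions are linear and homogeneous. This is what puts the increment [phi1 - phi0] in the
    domain of [L]. *)
Lemma bc_holdsP Omega bc (a : R) u v :
  bc_holds Omega bc u -> bc_holds Omega bc v ->
  bc_holds Omega bc (fun x => a * u x + v x).
Proof.
case: bc => [p q|] /= [cu bu] [cv bv]; split.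
- move=> x.
  exact: continuousD (continuousM (@cst_continuous _ _ a x) (cu x)) (cv x).
- by move=> x i; rewrite bu bv.
- move=> x; have ca := @cst_continuous (subspace (closure Omega)) _ a x.
  exact: continuousD (continuousM ca (cu x)) (cv x).
- move=> x nu xO xnu.
  (* The one-sided difference quotient is linear in the function, so its limit is the same
     combination of the two zero limits. *)
  have cw : a * (h^-1 * (u x - u (x - h *: nu)))
      + h^-1 * (v x - v (x - h *: nu)) @[h --> (0 : R)^'+] --> a * 0 + 0.
    by apply: cvgD (bv _ _ xO xnu); apply: cvgM (bu _ _ xO xnu); exact: cvg_cst.
  rewrite mulr0 addr0 in cw; apply: cvg_trans cw; apply: near_eq_cvg.
  by apply: nearW => h /=; ring.
Qed.

Lemma admissibleP Omega bc (X : set ('rV[R]_d -> R)) (a : R) u v :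
  linear_subspace X -> admissible Omega bc X u -> admissible Omega bc X v ->
  admissible Omega bc X (fun x => a * u x + v x).
Proof.
by move=> [_ XP] [Xu bu] [Xv bv]; split; [exact: XP|exact: bc_holdsP].
Qed.

(** Expanding [(L w, w)] with [w = u - v] gives two cross terms, equal by self-adjointness. The
    difference is spelled [-1 * v x + u x] to fit the shape [a * u + v] of [linear_operator]. *)
Lemma selfadjoint_polarization Omega (X : set ('rV[R]_d -> R)) L u v :
  measurable Omega -> L2_operator Omega X L -> linear_operator Omega X L ->
  selfadjoint_operator Omega X L ->
  X u -> X v -> X (fun x => -1 * v x + u x) ->
  let w := fun x => -1 * v x + u x in
  2 * inner_L2 Omega (L u) w =
  inner_L2 Omega (L u) u - inner_L2 Omega (L v) v + inner_L2 Omega (L w) w.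
Proof.
move=> mO L2L linL symL Xu Xv Xw w.
have [uL2 LuL2] := L2L _ Xu; have [vL2 LvL2] := L2L _ Xv.
have [wL2 _] := L2L _ Xw.
(* Linearity of [L] is known only at points of [Omega], so it is used under the integral. *)
have -> : inner_L2 Omega (L w) w =
    inner_L2 Omega (fun x => -1 * L v x + L u x) w.
  by apply: eq_inner_L2 => // x /set_mem; exact: linL.
have expand f : in_L2 Omega f ->
    inner_L2 Omega f w = - inner_L2 Omega f v + inner_L2 Omega f u.
  by move=> fL2; rewrite inner_L2C inner_L2Pl// mulN1r ![inner_L2 _ _ f]inner_L2C.
rewrite inner_L2Pl// !expand//.
have -> : inner_L2 Omega (L v) u = inner_L2 Omega (L u) v.
  by rewrite symL// inner_L2C.
by ring.
Qed.

Lemma modified_energyE Omega (L : ('rV[R]_d -> R) -> ('rV[R]_d -> R)) Ginv u r :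
  measurable Omega -> in_L2 Omega u -> in_L2 Omega (L u) ->
  modified_energy Omega L Ginv u r = 2^-1 * inner_L2 Omega (L u) u + Ginv r.
Proof.
move=> mO uL2 LuL2; congr (_ + _); rewrite RintegralZl//.
exact: in_L2_integrableM.
Qed.

End admissible_theory.

Theorem theorem4p1 (R : realType) (d : nat) (hd : (0 < d)%N)
  (Omega : set 'rV[R]_d) (hOmega : bounded_domain Omega)
  (bc : @boundary_condition R d) (hbc : bc_fits Omega bc)
  (* the operator L, on the functions of XL satisfying bc *)
  (XL : set ('rV[R]_d -> R)) (hXL : linear_subspace XL)
  (L : ('rV[R]_d -> R) -> ('rV[R]_d -> R))
  (hL_L2 : L2_operator Omega (admissible Omega bc XL) L)
  (hL_linear : linear_operator Omega (admissible Omega bc XL) L)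
  (hL_selfadjoint : selfadjoint_operator Omega (admissible Omega bc XL) L)
  (hL_positive : positive_operator Omega (admissible Omega bc XL) L)
  (* the operator calligraphic G, on the functions of XG satisfying bc *)
  (XG : set ('rV[R]_d -> R))
  (GG : ('rV[R]_d -> R) -> ('rV[R]_d -> R))
  (hGG_L2 : L2_operator Omega (admissible Omega bc XG) GG)
  (hGG_positive : positive_operator Omega (admissible Omega bc XG) GG)
  (* the potential F, defined on DF, and its variational derivative F' *)
  (DF : set ('rV[R]_d -> R))
  (F F' : ('rV[R]_d -> R) -> ('rV[R]_d -> R))
  (hF' : forall phi, DF phi ->
     variational_derivative Omega (admissible Omega bc XL) F phi (F' phi))
  (hF'_L2 : forall phi, DF phi -> in_L2 Omega (F' phi))
  (* the scalar bijection G from A onto B, and its inverse *)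
  (A B : set R) (G Ginv : R -> R)
  (hG : set_bij A B G) (hGinv : {in A, cancel G Ginv})
  (dt : R) (hdt : 0 < dt)
  (phi0 phi1 mu1 : 'rV[R]_d -> R) (r0 r1 : R)
  (hphi0 : admissible Omega bc XL phi0) (hphi0F : DF phi0)
  (hphi1 : admissible Omega bc XL phi1)
  (hmu1 : admissible Omega bc XG mu1)
  (hr0 : B r0) (hr1 : B r1)
  (hA : A (potential_integral Omega F phi0))
  (hG0 : G (potential_integral Omega F phi0) != 0)
  (scheme1 : forall x, Omega x -> (phi1 x - phi0 x) / dt = - GG mu1 x)
  (scheme2 : forall x, Omega x ->
     mu1 x = L phi1 x + r0 / G (potential_integral Omega F phi0) * F' phi0 x)
  (scheme3 : (Ginv r1 - Ginv r0) / dt =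
     r0 / G (potential_integral Omega F phi0) *
     inner_L2 Omega (F' phi0) (fun x => (phi1 x - phi0 x) / dt)) :
  modified_energy Omega L Ginv phi1 r1 - modified_energy Omega L Ginv phi0 r0
    <= - dt * inner_L2 Omega (GG mu1) mu1.
Proof.
have mO : measurable Omega by apply: open_measurable_rV; case: hOmega.
set c := r0 / _ in scheme2 scheme3.
set w := fun x => -1 * phi0 x + phi1 x.
have aw : admissible Omega bc XL w by exact: admissibleP.
have [phi0L2 Lphi0L2] := hL_L2 _ hphi0; have [phi1L2 Lphi1L2] := hL_L2 _ hphi1.
have [wL2 _] := hL_L2 _ aw; have [mu1L2 GGL2] := hGG_L2 _ hmu1.
have F'L2 := hF'_L2 _ hphi0F.
(* On [Omega], [scheme1] turns [- dt * GG mu1] into [w], and [scheme2] expands the other factor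
   [mu1]. *)
have tested : - dt * inner_L2 Omega (GG mu1) mu1 =
    c * inner_L2 Omega (F' phi0) w + inner_L2 Omega (L phi1) w.
  rewrite -(inner_L2Zl mO (- dt))// -(inner_L2Pl mO c)// [RHS]inner_L2C.
  apply: eq_inner_L2 => x /set_mem Ox; last by rewrite scheme2// addrC.
  rewrite mulNr -mulrN -scheme1// mulrC divfK ?gt_eqF// /w; ring.
have dGinv : Ginv r1 - Ginv r0 = c * inner_L2 Omega (F' phi0) w.
  (* Dividing by [dt] gives the left side of [scheme3]; the factor [dt^-1] inside its inner product
     is then pulled out. *)
  apply: (@mulIf _ dt^-1); first by rewrite invr_neq0// gt_eqF.
  rewrite scheme3 (_ : inner_L2 _ _ _ = dt^-1 * inner_L2 Omega (F' phi0) w).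
    by rewrite mulrCA mulrC.
  rewrite inner_L2C [in RHS]inner_L2C -(inner_L2Zl mO)//.
  by apply: eq_inner_L2 => // x _; rewrite /w; ring.
have := selfadjoint_polarization mO hL_L2 hL_linear hL_selfadjoint hphi1 hphi0 aw.
have := hL_positive _ aw.
(* The [Ginv] terms now agree on both sides; what remains is half the polarization identity with
   [(L w, w) >= 0] dropped. *)
rewrite !modified_energyE// tested -dGinv -/w /=.
lra.
Qed.
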